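(* There is an absolute constant $c$ such that the following holds. Let $G$ be an $n$-vertex topological graph such that for every two crossing edges $e$ and $e'$ of $G$, the edges $e$ and $e'$ are independent and there is a crossing-free edge of $G$ that connects an endpoint of $e$ and an endpoint of $e'$. Then $G$ has at most $cn$ edges.
   Context: Graphs have no loops or parallel edges. A topological graph is a graph drawn in the plane with its vertices as distinct points and its edges as Jordan arcs connecting the corresponding points and not containing any other vertex as an interior point; every pair of edges has finitely many intersection points, each of which is either a common vertex or a crossing point (where one edge passes from one side of the other to its other side). Two edges cross if they have a crossing point. Two edges are independent if they do not share a vertex. An edge is crossing-free if it crosses no other edge of the graph. *)

(* Defs.v *)
From HB Require Import structures.
From mathcomp Require Import all_boot all_order all_algebra.
From mathcomp Require Import all_classical all_reals all_analysis.
Import numFieldNormedType.Exports.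
Set Implicit Arguments. Unset Strict Implicit. Unset Printing Implicit Defensive.
Import Order.TTheory GRing.Theory Num.Theory.
Local Open Scope classical_set_scope.
Local Open Scope ring_scope.

Section TopGraph.
Variable R : realType.
Notation plane := (R * R)%type.

Definition unit_int : set R := [set t | 0 <= t <= 1].

Definition arc_img (f : R -> plane) : set plane := f @` unit_int.

Definition jordan_arc (f : R -> plane) : Prop :=
  {within unit_int, continuous f} /\
  (forall s t, unit_int s -> unit_int t -> f s = f t -> s = t).

(* p is a (proper) crossing point of the arcs f and g: p is a common interior
   point, and near p the pair (f, g) is homeomorphic to the two coordinate axes
   crossing at the origin, i.e. one arc passes from one side of the other arc to
   its other side. *)
Definition crossing_point (f g : R -> plane) (p : plane) : Prop :=
  arc_img f p /\ arc_img g p /\ f 0 <> p /\ f 1 <> p /\ g 0 <> p /\ g 1 <> p /\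
  exists (U : set plane) (h k : plane -> plane),
    open U /\ U p /\ open (h @` U) /\
    {within U, continuous h} /\ {within h @` U, continuous k} /\
    (forall x, U x -> k (h x) = x) /\
    h p = (0, 0) /\
    h @` (arc_img f `&` U) = h @` U `&` [set q | q.2 = 0] /\
    h @` (arc_img g `&` U) = h @` U `&` [set q | q.1 = 0].

Definition topological_graph (V : finType) (adj : rel V) (pos : V -> plane)
    (arc : V -> V -> R -> plane) : Prop :=
  [/\ (forall u, ~~ adj u u) /\ (forall u v, adj u v = adj v u),
      injective pos,
      (forall u v, adj u v ->
         [/\ jordan_arc (arc u v), arc u v 0 = pos u, arc u v 1 = pos v &
             forall t, unit_int t -> arc v u t = arc u v (1 - t)]),
      (forall u v w, adj u v -> w != u -> w != v -> ~ arc_img (arc u v) (pos w)) &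
      (forall u v x y, adj u v -> adj x y -> ~~ (((u == x) && (v == y)) || ((u == y) && (v == x))) ->
         finite_set (arc_img (arc u v) `&` arc_img (arc x y)) /\
         forall p, arc_img (arc u v) p -> arc_img (arc x y) p ->
           (exists w, [/\ (w == u) || (w == v), (w == x) || (w == y) & p = pos w])
           \/ crossing_point (arc u v) (arc x y) p)].

Definition edges_cross (V : finType) (adj : rel V) (arc : V -> V -> R -> plane)
    (u v x y : V) : Prop :=
  adj u v /\ adj x y /\ exists p, crossing_point (arc u v) (arc x y) p.

Definition crossing_free (V : finType) (adj : rel V) (arc : V -> V -> R -> plane)
    (a b : V) : Prop :=
  adj a b /\ forall x y, ~ edges_cross adj arc a b x y.

End TopGraph.

Local Close Scope classical_set_scope.

Definition num_edges (V : finType) (adj : rel V) : nat :=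
  #|[set [set x.1; x.2] | x in [set x : V * V | adj x.1 x.2]]|.

(* Main.v *)
(* Let g consist of the crossing-free edges.  If a vertex set B is independent in g, then no
   two edges inside B cross.  Both g and the restriction of the graph to such a B are
   therefore plane, and plane graphs are sparse: every vertex set A spans O(|A|) edges.  So
   g is O(1)-degenerate; orienting it with bounded out-degrees and deleting from a random
   vertex set every vertex with a chosen out-neighbour yields a random g-independent set
   containing both ends of any edge outside g with probability bounded below.  Averaging
   bounds the number of those edges.

   Sparsity of plane graphs: contracting edges with few common neighbours shows that a dense
   graph contains five vertices joined by ten connected sets, disjoint for independent edges
   of K_5.  In the plane, such sets are replaced by fine chains of points, and the van Kampen
   obstruction of K_5, computed with mod 2 winding numbers, rules them out. *)
Require Import Defs.
From HB Require Import structures.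
From mathcomp Require Import all_boot all_order all_algebra.
From mathcomp Require Import all_classical all_reals all_analysis.
From mathcomp Require Import lra zify.
From Stdlib Require Import Btauto.
Import numFieldNormedType.Exports.
Import Order.TTheory GRing.Theory Num.Theory.
Set Implicit Arguments. Unset Strict Implicit. Unset Printing Implicit Defensive.

(** * The van Kampen obstruction for chains of points *)

Section Parity.
Local Open Scope ring_scope.
Variable R : realFieldType.
Implicit Types (x y z a b p q : R * R) (s t : seq (R * R)) (d : R).

(* The tie-break on the horizontal axis makes [below] exactly odd away from 0. *)
Definition below z : bool := (z.2 < 0) || ((z.2 == 0) && (z.1 < 0)).

(** Detects a step across the half-axis to the right of 0. The sign at [z] alone suffices for steps
    short compared with the distance from 0: if [below] changes, the step stays on one side of the
    vertical axis. *)
Definition ray_cross z z' : bool := (below z (+) below z') && (0 < z.1).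

Definition in_box d x y : bool := (`|x.1 - y.1| < d) && (`|x.2 - y.2| < d).

(* Parity of the number of times the chain [x :: s] crosses the ray to the right of [p]
   ([cowind]: the same for the reflected chain, seen as the motion of [p] relative to it). *)
Fixpoint wind p x s : bool :=
  if s is y :: s' then ray_cross (x - p) (y - p) (+) wind p y s' else false.

Fixpoint cowind p x s : bool :=
  if s is y :: s' then ray_cross (p - x) (p - y) (+) cowind p y s' else false.

Lemma below_opp z : z != 0 -> below (- z) = ~~ below z.
Proof.
case: z => u v; rewrite /below -pair_eqE /= => nz.
rewrite !oppr_lt0 oppr_eq0.
case: (ltgtP v 0) nz => //= _; rewrite andbT.
by case: ltgtP.
Qed.

Lemma addb_xorb (u v : bool) : u (+) v = xorb u v.
Proof. by case: u; case: v. Qed.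

(** All four differences are within [2d] of [a - b] coordinatewise, and some coordinate of [a - b]
    has size at least [4d], so it keeps its sign. If it is the first, the changes of [below] cancel
    around the square; if the second, [below] is constant. *)
Lemma ray_cross_square d a a' b b' :
  in_box d a a' -> in_box d b b' -> ~~ in_box (d *+ 4) a b ->
  ray_cross (a - b) (a' - b) (+) ray_cross (a' - b) (a' - b')
    (+) ray_cross (a - b') (a' - b') (+) ray_cross (a - b) (a - b') = false.
Proof.
case: a a' b b' => [a1 a2] [c1 c2] [b1 b2] [e1 e2].
rewrite /in_box /ray_cross /below /= !ltr_norml => /andP[/andP[h1 h2] /andP[h3 h4]].
move=> /andP[/andP[h5 h6] /andP[h7 h8]].
have sgn (x y : R) : y < - (d *+ 2) \/ d *+ 2 < y -> y - d - d < x < y + d + d ->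
    [/\ (x < 0) = (y < 0), (0 < x) = (0 < y) & (x == 0) = (y == 0)].
  move=> hy /andP[hx1 hx2]; split.
  - by apply/idP/idP => ?; lra.
  - by apply/idP/idP => ?; lra.
  - by apply/eqP/eqP => ?; lra.
rewrite negb_and => /orP[h|h].
- have hy : a1 - b1 < - (d *+ 2) \/ d *+ 2 < a1 - b1.
    case: (ltP (a1 - b1) (- (d *+ 2))) => ?; [by left|right].
    by apply: contraNT h => ?; apply/andP; split; lra.
  have [] // := sgn (c1 - b1) _ hy; first by apply/andP; split; lra.
  have [] // := sgn (a1 - e1) _ hy; first by apply/andP; split; lra.
  move=> _ -> _ _ -> _.
  by case: (0 < a1 - b1); rewrite ?andbF // !andbT; rewrite !addb_xorb; btauto.
- have hy : a2 - b2 < - (d *+ 2) \/ d *+ 2 < a2 - b2.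
    case: (ltP (a2 - b2) (- (d *+ 2))) => ?; [by left|right].
    by apply: contraNT h => ?; apply/andP; split; lra.
  have nz : (a2 - b2 == 0) = false by apply/eqP => ?; lra.
  have [] // := sgn (c2 - b2) _ hy; first by apply/andP; split; lra.
  have [] // := sgn (c2 - e2) _ hy; first by apply/andP; split; lra.
  have [] // := sgn (a2 - e2) _ hy; first by apply/andP; split; lra.
  move=> -> _ -> -> _ -> -> _ ->.
  by rewrite nz /= orbF addbb.
Qed.

(** Adding [ray_cross_square] along the chain cancels the sides shared by consecutive squares. *)
Lemma wind_strip d b b' x s :
  path (in_box d) x s -> in_box d b b' -> all (fun a => ~~ in_box (d *+ 4) a b) (x :: s) ->
  wind b x s (+) wind b' x s
    = ray_cross (last x s - b) (last x s - b') (+) ray_cross (x - b) (x - b').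
Proof.
move=> + bb'; elim: s x => [|y s IH] x /=; first by rewrite addbb.
case/andP=> xy ys /andP[hx hs].
have := ray_cross_square xy bb' hx.
have := IH y ys hs.
move: (wind b y s) (wind b' y s) => [] []; do 5 case: ray_cross => //=; by case: ray_cross.
Qed.

(** A discrete homotopy argument: the differences of the two chains form a grid that avoids 0, so
    the crossing parity along its boundary vanishes. *)
Lemma wind_rect d x s y t :
  path (in_box d) x s -> path (in_box d) y t ->
  (forall a b, a \in x :: s -> b \in y :: t -> ~~ in_box (d *+ 4) a b) ->
  wind y x s (+) wind (last y t) x s = cowind (last x s) y t (+) cowind x y t.
Proof.
move=> xs; elim: t y => [|z t IH] y /=; first by rewrite addbb.
case/andP=> yz zt sep.
have sepy : all (fun a => ~~ in_box (d *+ 4) a y) (x :: s).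
  by apply/allP => a ha; apply: sep => //; exact: mem_head.
have := wind_strip xs yz sepy.
have := IH z zt (fun a b ha hb => sep a b ha (mem_behead (s := y :: z :: t) hb)).
move: (wind y x s) (wind z x s) => [] []; move: (wind (last z t) x s) => [];
move: (cowind (last x s) z t) (cowind x z t) => [] []; by do 2 case: ray_cross.
Qed.

(** Negation swaps the right and left half-axes, and a change of [below] means crossing exactly one
    of them. *)
Lemma ray_cross_opp d a a' p : in_box d a a' -> ~~ in_box (d *+ 4) a p ->
  ray_cross (p - a) (p - a')
    = ray_cross (a - p) (a' - p) (+) below (a - p) (+) below (a' - p).
Proof.
move=> aa' ap.
have za : a - p != 0.
  apply: contraNneq ap => /subr0_eq ->; move: aa'.
  rewrite /in_box !subrr !normr0 => /andP[/(le_lt_trans (normr_ge0 _)) ? _].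
  by rewrite !mulrn_wgt0.
have za' : a' - p != 0.
  apply: contraNneq ap => /subr0_eq <-; move: aa'.
  rewrite /in_box => /andP[ha hb]; apply/andP.
  have d0 := le_lt_trans (normr_ge0 _) ha.
  by split; lra.
rewrite -[p - a]opprB -[p - a']opprB.
rewrite /ray_cross !below_opp //.
(* A step that changes [below] starts near the horizontal axis, hence at a nonzero first
   coordinate. *)
suff: below (a - p) != below (a' - p) -> (0 < (- (a - p)).1) = ~~ (0 < (a - p).1).
  by move: (below (a - p)) (below (a' - p)) => [] [] //= ->; case: (0 < a.1 - p.1).
case: a a' p aa' ap za za' => [a1 a2] [c1 c2] [p1 p2].
rewrite /in_box /below /= !ltr_norml => /andP[/andP[h1 h2] /andP[h3 h4]] h _ _.
have [a1p|a1p|e] := ltgtP (a1 - p1) 0 => hb.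
- by rewrite oppr_gt0 a1p.
- by rewrite oppr_gt0 ltNge ltW.
exfalso; move: h; rewrite e => h.
have d0 : 0 < d by lra.
have hy : a2 - p2 <= - (d *+ 4) \/ d *+ 4 <= a2 - p2.
  case: (lerP (a2 - p2) (- (d *+ 4))) => ?; [by left|right].
  by rewrite leNgt; apply: contraNN h => ?; apply/andP; split; lra.
have nz : (a2 - p2 == 0) = false by apply/eqP => ?; lra.
have nz' : (c2 - p2 == 0) = false by apply/eqP => ?; lra.
move: hb; rewrite nz nz' !andFb !orbF => /negP; apply.
by apply/eqP; apply/idP/idP => ?; lra.
Qed.

Lemma cowindE d p x s :
  path (in_box d) x s -> all (fun a => ~~ in_box (d *+ 4) a p) (x :: s) ->
  cowind p x s = wind p x s (+) below (x - p) (+) below (last x s - p).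
Proof.
elim: s x => [|y s IH] x /=; first by rewrite addbb.
case/andP=> xy ys /andP[hx hs]; rewrite (ray_cross_opp xy hx) (IH y ys hs).
by move: (wind _ _ _) (ray_cross _ _) => [] []; do 3 case: below.
Qed.

(** In [wind_rect], both cowindings become windings; the endpoint corrections from [cowindE] form
    the right-hand side. *)
Lemma wind_independent d x s y t :
  path (in_box d) x s -> path (in_box d) y t ->
  (forall a b, a \in x :: s -> b \in y :: t -> ~~ in_box (d *+ 4) a b) ->
  wind y x s (+) wind (last y t) x s (+) wind x y t (+) wind (last x s) y t
  = below (y - x) (+) below (last y t - x)
    (+) below (y - last x s) (+) below (last y t - last x s).
Proof.
move=> xs yt sep; have := wind_rect xs yt sep.
have sepC a b : a \in x :: s -> b \in y :: t -> ~~ in_box (d *+ 4) b a.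
  by move=> ha hb; rewrite /in_box distrC [X in _ && (X < _)]distrC sep.
rewrite !(cowindE yt).
- move: (wind x y t) (wind (last x s) y t) => [] [];
  move: (wind y x s) (wind (last y t) x s) => [] []; by do 4 case: below.
- by apply/allP => b; apply: sepC; exact: mem_head.
- by apply/allP => b; apply: sepC; exact: mem_last.
Qed.

Lemma below_anti x y : x != y -> below (x - y) = ~~ below (y - x).
Proof. by move=> xy; rewrite -opprB below_opp // subr_eq0 eq_sym. Qed.

(* Summing [wind_independent] over the 15 pairs of independent edges of K_5, every
   winding parity occurs twice, whereas the right-hand sides add up to 1. *)
Lemma no_planar_K5 d (c : nat -> R * R) (s : nat -> nat -> seq (R * R)) :
  (forall i j, (i < j < 5)%N -> path (in_box d) (c i) (s i j)) ->
  (forall i j, (i < j < 5)%N -> last (c i) (s i j) = c j) ->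
  (forall i j, (i < j < 5)%N -> c i != c j) ->
  (forall i j k l, (i < j < 5)%N -> (k < l < 5)%N ->
     i != k -> i != l -> j != k -> j != l ->
     forall a b, a \in c i :: s i j -> b \in c k :: s k l -> ~~ in_box (d *+ 4) a b) ->
  False.
Proof.
move=> sp sl cI sep.
pose N k i j := wind (c k) (c i) (s i j).
pose h i j := below (c i - c j).
have E i j k l : (i < j < 5)%N -> (k < l < 5)%N ->
    i != k -> i != l -> j != k -> j != l ->
    N k i j (+) N l i j (+) N i k l (+) N j k l = h k i (+) h l i (+) h k j (+) h l j.
  move=> ij kl *; have := wind_independent (sp _ _ ij) (sp _ _ kl).
  by rewrite !sl //; apply; apply: sep.
have A i j : (i < j < 5)%N -> h j i = ~~ h i j.
  by move=> ij; rewrite /h below_anti // eq_sym cI.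
have e1 := E 0 1 2 3 isT isT isT isT isT isT.
have e2 := E 0 1 2 4 isT isT isT isT isT isT.
have e3 := E 0 1 3 4 isT isT isT isT isT isT.
have e4 := E 0 2 1 3 isT isT isT isT isT isT.
have e5 := E 0 2 1 4 isT isT isT isT isT isT.
have e6 := E 0 2 3 4 isT isT isT isT isT isT.
have e7 := E 0 3 1 2 isT isT isT isT isT isT.
have e8 := E 0 3 1 4 isT isT isT isT isT isT.
have e9 := E 0 3 2 4 isT isT isT isT isT isT.
have e10 := E 0 4 1 2 isT isT isT isT isT isT.
have e11 := E 0 4 1 3 isT isT isT isT isT isT.
have e12 := E 0 4 2 3 isT isT isT isT isT isT.
have e13 := E 1 2 3 4 isT isT isT isT isT isT.
have e14 := E 1 3 2 4 isT isT isT isT isT isT.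
have e15 := E 1 4 2 3 isT isT isT isT isT isT.
have add2 (a b a' b' : bool) : a = b -> a' = b' -> a (+) a' = b (+) b' by move=> -> ->.
have := add2 _ _ _ _ e1 (add2 _ _ _ _ e2 (add2 _ _ _ _ e3 (add2 _ _ _ _ e4
  (add2 _ _ _ _ e5 (add2 _ _ _ _ e6 (add2 _ _ _ _ e7 (add2 _ _ _ _ e8
  (add2 _ _ _ _ e9 (add2 _ _ _ _ e10 (add2 _ _ _ _ e11 (add2 _ _ _ _ e12
  (add2 _ _ _ _ e13 (add2 _ _ _ _ e14 e15))))))))))))).
(* With smaller index first, each of the ten [h i j] occurs six times and cancels. The number of
   negations left is odd exactly for the five pairs of edges whose ends interleave. *)
rewrite (A 0 1) // (A 0 2) // (A 0 3) // (A 0 4) // (A 1 2) // (A 1 3) //.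
rewrite (A 1 4) // (A 2 3) // (A 2 4) // (A 3 4) //.
clear; move: N h => N h.
have absurd (l r : bool) : l = false -> r = true -> l = r -> False by move=> -> ->.
apply: absurd.
all: by rewrite !addb_xorb; btauto.
Qed.
End Parity.

(** * From connected sets to chains *)

Section PlaneTopology.
Local Open Scope ring_scope.
Local Open Scope classical_set_scope.
Variable R : realType.
Implicit Types (X Y : set (R * R)) (a b p q : R * R) (d : R).

Lemma in_boxE d a b : in_box d a b <-> ball a d b.
Proof. by split => [/andP[]|[h1 h2]]; [split|apply/andP; split]. Qed.

(** The points reachable from [p] by such chains form a nonempty subset that is both open and closed
    in [X]. *)
Lemma connected_chain d X p q : connected X -> 0 < d -> X p -> X q ->
  exists s, [/\ path (in_box d) p s, last p s = q & forall a, a \in p :: s -> X a].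
Proof.
move=> cX d0 Xp; pose B := [set q | exists s, [/\ path (in_box d) p s, last p s = q &
  forall a, a \in p :: s -> X a]].
have BX b : B b -> X b by move=> [s [_ <-]]; apply; exact: mem_last.
have Bstep b b' : B b -> X b' -> in_box d b b' -> B b'.
  move=> [s [ps <- sX]] Xb' bb'; exists (rcons s b'); split.
  - by rewrite rcons_path ps.
  - by rewrite last_rcons.
  - by move=> a; rewrite -rcons_cons mem_rcons inE => /predU1P[->//|/sX].
suff BE : B = X by move=> Xq; have : B q by rewrite BE.
apply: cX.
- by exists p, [::]; split=> // a; rewrite inE => /eqP ->.
- exists (\bigcup_(b in B) (ball b d)°).
    by apply: bigcup_open => b _; exact: open_interior.
  apply/seteqP; split=> [b Bb|b [Xb [b' Bb' /interior_subset /in_boxE]]].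
    by split; [exact: BX|exists b => //; exact: nbhsx_ballx].
  exact: Bstep.
- exists (~` \bigcup_(b in X `\` B) (ball b d)°).
    by apply: open_closedC; apply: bigcup_open => b _; exact: open_interior.
  apply/seteqP; split=> [b Bb|b [Xb nb]].
    split; first exact: BX.
    move=> [b' [Xb' nBb'] /interior_subset/ball_sym/in_boxE].
    by move=> bb'; apply: nBb'; exact: Bstep bb'.
  apply: contrapT => nBb; apply: nb; exists b; first by [].
  exact: nbhsx_ballx.
Qed.

(** Near [a], half the radius of a ball around [a] missing [Y] works; compactness of [X] makes this
    uniform. Holding for all small [d], finitely many separations can be met at once. *)
Lemma compact_separated X Y : compact X -> compact Y -> X `&` Y = set0 ->
  \forall d \near 0^'+, forall a b, X a -> Y b -> ~~ in_box d a b.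
Proof.
move=> cX cY XY.
have clY : closed Y.
  by apply: compact_closed => //; exact: pseudoMetricNormedZModType_hausdorff.
have /compact_near_coveringP := cX.
move=> /(_ R 0^'+ (fun d a => forall b, Y b -> ~~ in_box d a b) _) H.
have {}H : \forall d \near 0^'+, X `<=` (fun a => forall b, Y b -> ~~ in_box d a b).
  apply: H => a Xa.
  have : nbhs a (~` Y).
    apply: open_nbhs_nbhs; split; first exact: closed_openC.
    by move=> Ya; have : (X `&` Y) a by []; rewrite XY.
  move=> /nbhs_ballP[e /= e0 eY].
  exists (ball a (e / 2), [set d | d < e / 2]).
    split; first by apply: nbhsx_ballx; rewrite divr_gt0.
    by apply: nbhs_right_lt; rewrite divr_gt0.
  move=> [a' d] /= [aa' de] b Yb; apply/negP => /in_boxE a'b.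
  apply: (eY b) => //; apply: ball_split aa' _.
  exact: le_ball (ltW de) _ a'b.
by apply: filterS H => d H a b Xa; exact: H.
Qed.

End PlaneTopology.

(** * Dense graphs contain K_5 *)

Section DenseModel.
Variable V : finType.
Implicit Types (A B S : {set V}) (g : rel V) (c : nat -> V).

Definition inside g S : rel V := fun u v => [&& u \in S, v \in S & g u v].

Definition nbhd g A v : {set V} := [set w in A | g v w].

(** For symmetric [g] every edge is counted twice, so the cardinal is a degree sum. *)
Definition arcs g A : {set V * V} :=
  [set p | [&& p.1 \in A, p.2 \in A & g p.1 p.2]].

(* A drawing-friendly weakening of a K_t-minor: disjointness is only required of the
   connections realizing independent edges of K_t. *)
Definition Kmodel t g A : Prop :=
  exists c (S : nat -> nat -> {set V}),
  [/\ (forall i, i < t -> c i \in A) /\ (forall i j, i < j < t -> c i != c j),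
      forall i j, i < j < t -> [/\ S i j \subset A, c i \in S i j, c j \in S i j &
         connect (inside g (S i j)) (c i) (c j)],
      forall i j k, i < j < t -> k < t -> k != i -> k != j -> c k \notin S i j &
      forall i j k l, i < j < t -> k < l < t ->
         i != k -> i != l -> j != k -> j != l -> [disjoint S i j & S k l]].

Lemma card_arcs g A : #|arcs g A| = \sum_(u in A) #|nbhd g A u|.
Proof.
rewrite -sum1_card (partition_big fst (mem A)) /=; last first.
  by move=> [u w]; rewrite inE => /and3P[].
apply: eq_bigr => u uA; rewrite -sum1_card.
rewrite (reindex_onto (fun w => (u, w)) snd) /=; last first.
  by move=> [a b] /= /andP[_ /eqP ->].
by apply: eq_bigl => w; rewrite !inE /= !eqxx !andbT uA.
Qed.

Lemma Kmodel1 g A : A != finset.set0 -> Kmodel 1 g A.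
Proof.
case/set0Pn=> x xA; exists (fun=> x), (fun _ _ => finset.set0); split=> //.
- by split=> // i j; lia.
- by move=> i j; lia.
- by move=> i j k; lia.
- by move=> i j k l; lia.
Qed.

Lemma Kmodel_sub t g A B : A \subset B -> Kmodel t g A -> Kmodel t g B.
Proof.
move=> sAB [c [S [[h1 h1'] h2 h3 h4]]]; exists c, S; split=> //.
- by split=> // i /h1 /(fintype.subsetP sAB).
- by move=> i j /h2[sS *]; split=> //; exact: fintype.subset_trans sAB.
Qed.

(** The pairs [[set c i; v]] realize the new edges. They all share [v], as edges with a common end
    may, and they avoid the old sets of independent edges, which lie in [A] and miss [c i]. *)
Lemma Kmodel_cone t g A v : v \notin A -> (forall w, w \in A -> g w v) ->
  Kmodel t g A -> Kmodel t.+1 g (v |: A).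
Proof.
move=> vA gv [c [S [[h1 h1'] h2 h3 h4]]].
pose c' i := if i == t then v else c i.
pose S' i j := if j == t then [set c i; v] else S i j.
have lt_ne i : i < t -> (i == t) = false by move=> it; rewrite ltn_eqF.
have cE i : i < t -> c' i = c i by move=> it; rewrite /c' lt_ne.
have ct : c' t = v by rewrite /c' eqxx.
have SE i j : j < t -> S' i j = S i j by move=> it; rewrite /S' lt_ne.
have St i : S' i t = [set c i; v] by rewrite /S' eqxx.
have vS i j : i < j < t -> v \notin S i j.
  by move=> ij; have [/fintype.subsetP sS _ _ _] := h2 _ _ ij; apply: contra vA => /sS.
have cv i : i < t -> c i != v by move=> /h1; apply: contraTneq => ->.
have cI i j : i < t -> j < t -> i != j -> c i != c j.
  move=> it jt; rewrite neq_ltn => /orP[] lt; last rewrite eq_sym.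
  - by apply: h1'; rewrite lt.
  - by apply: h1'; rewrite lt.
have caseS i j : i < j < t.+1 -> (i < j < t) \/ (j = t /\ i < t).
  by case/andP=> ij; rewrite ltnS leq_eqVlt => /predU1P[jt|jt]; [right; split; rewrite // -jt|left; rewrite ij].
have dis i k l : i < t -> k < l < t -> i != k -> i != l -> [disjoint [set c i; v] & S k l].
  move=> it kl ik il; rewrite finset.disjoints_subset; apply/fintype.subsetP => x.
  by rewrite !inE => /orP[] /eqP ->; [exact: h3|exact: vS].
exists c', S'; split.
- split=> [i|i j /caseS[ij|[-> it]]].
  + rewrite ltnS leq_eqVlt => /predU1P[->|it]; first by rewrite ct setU11.
    by rewrite cE // inE h1 // orbT.
  + have jt : j < t by case/andP: ij.
    rewrite !cE //; first exact: h1'.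
    by apply: ltn_trans jt; case/andP: ij.
  + by rewrite ct cE // cv.
- move=> i j /caseS[ij|[-> it]].
  + have jt : j < t by case/andP: ij.
    have it : i < t by apply: ltn_trans jt; case/andP: ij.
    rewrite !cE // SE //; have [sS ci cj cn] := h2 _ _ ij; split=> //.
    by apply: fintype.subset_trans sS _; exact: subsetU1.
  + rewrite St ct cE //; split; rewrite ?inE ?eqxx ?orbT //.
      by apply/fintype.subsetP => x; rewrite !inE => /orP[] /eqP ->; rewrite ?eqxx ?h1 ?orbT.
    by apply: connect1; rewrite /inside !inE !eqxx orbT /= gv // h1.
- move=> i j k /caseS[ij|[-> it]].
  + have jt : j < t by case/andP: ij.
    rewrite SE // ltnS leq_eqVlt => /predU1P[->|kt] ki kj; first by rewrite ct vS.
    by rewrite cE // h3.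
  + rewrite St ltnS leq_eqVlt => /predU1P[->|kt] ki; first by rewrite eqxx.
    by move=> _; rewrite cE // !inE negb_or cv // cI.
- move=> i j k l /caseS[ij|[-> it]] /caseS[kl|[-> kt]] ik il jk jl.
  + by rewrite !SE ?h4 //; [case/andP: kl|case/andP: ij].
  + rewrite St SE; last by case/andP: ij.
    by rewrite disjoint_sym dis // eq_sym.
  + rewrite St SE; last by case/andP: kl.
    by rewrite dis // eq_sym.
  + by rewrite eqxx in jl.
Qed.

(** Merges [y] into [x]. The vertex [y] stays in the type, so this is used on [A :\ y]; the test
    [a != b] removes the loop created at [x]. *)
Definition contract g (x y : V) : rel V := fun a b =>
  (a != b) && [|| g a b, (a == x) && g y b | (b == x) && g a y].

(** Add [y] to every set containing [x]: an edge inherited from [y] becomes a path through [y], and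
    sets sharing [y] would already share [x]. *)
Lemma Kmodel_contract t g A x y :
  symmetric g -> g x y -> x \in A -> y \in A ->
  Kmodel t (contract g x y) (A :\ y) -> Kmodel t g A.
Proof.
move=> gC gxy xA yA [c [S [[h1 h1'] h2 h3 h4]]].
pose S' i j := S i j :|: (if x \in S i j then [set y] else finset.set0).
have mem a i j : a \in S i j -> a \in S' i j by rewrite inE => ->.
have memy i j : x \in S i j -> y \in S' i j by rewrite !inE => ->; rewrite set11 orbT.
have S'P a i j : a \in S' i j -> a \in S i j \/ a = y /\ x \in S i j.
  rewrite inE => /orP[|]; first by left.
  by case: ifP => xS; rewrite inE // => /eqP; right.
have cy i : i < t -> c i != y by move=> /h1; rewrite !inE => /andP[].
have yS i j : i < j < t -> y \notin S i j.
  by move=> ij; have [/fintype.subsetP sS _ _ _] := h2 _ _ ij; apply/negP => /sS; rewrite !inE eqxx.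
exists c, S'; split.
- by split=> // i /h1; rewrite !inE => /andP[].
- move=> i j ij; have [sS ci cj cn] := h2 _ _ ij; split; rewrite ?mem //.
    apply/fintype.subsetP => a /S'P[/(fintype.subsetP sS)|[-> _]//].
    by rewrite !inE => /andP[].
  apply: connect_sub cn => a b /and3P[aS bS /andP[ab]].
  case/or3P=> [gab|/andP[/eqP ax gyb]|/andP[/eqP bx gay]].
  + by apply: connect1; rewrite /inside !mem.
  + subst a; apply: (@connect_trans _ _ y); apply: connect1.
      by rewrite /inside memy // mem // gxy.
    by rewrite /inside memy // mem.
  + subst b; apply: (@connect_trans _ _ y); apply: connect1.
      by rewrite /inside memy // mem.
    by rewrite /inside memy // mem // gC.
- move=> i j k ij kt ki kj; apply/negP => /S'P[ck|[ck _]]; first by have /negP := h3 i j k ij kt ki kj.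
  by have := cy _ kt; rewrite ck eqxx.
- move=> i j k l ij kl ik il jk jl; have d := h4 _ _ _ _ ij kl ik il jk jl.
  rewrite finset.disjoints_subset; apply/fintype.subsetP => a aS.
  rewrite finset.in_setC; apply/negP => aS'; have [ay|ay] := eqVneq a y.
    subst a; case: (S'P _ _ _ aS) => [yS1|[_ xS]]; first by have /negP := yS i j ij.
    case: (S'P _ _ _ aS') => [yS1|[_ xS']]; first by have /negP := yS k l kl.
    by have := disjointFr d xS; rewrite xS'.
  case: (S'P _ _ _ aS) => [{}aS|[e]]; last by rewrite e eqxx in ay.
  case: (S'P _ _ _ aS') => [{}aS'|[e]]; last by rewrite e eqxx in ay.
  by have := disjointFr d aS; rewrite aS'.
Qed.

(** Contraction loses the edge [xy] and, for each common neighbour, one of two edges made parallel;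
    each accounts for two arcs. *)
Lemma arcs_contract g A x y : symmetric g -> irreflexive g -> g x y -> x \in A -> y \in A ->
  #|arcs g A| <= #|arcs (contract g x y) (A :\ y)| + (#|nbhd g (nbhd g A x) y|.+1).*2.
Proof.
move=> gC gI gxy xA yA.
(* The neighbours of [y] that become new neighbours of [x]. *)
pose L := [set w in A | [&& w != x, g y w & ~~ g x w]].
have yx : y != x by apply: contraTneq gxy => ->; rewrite gI.
have nbhdy : nbhd g A y = [set x] :|: nbhd g (nbhd g A x) y :|: L.
  apply/setP => w; rewrite !inE; have [->|wx] /= := eqVneq w x; first by rewrite xA gC gxy.
  by case: (w \in A) => //=; case: (g y w); case: (g x w).
have nbhdy_le : #|nbhd g A y| <= #|nbhd g (nbhd g A x) y|.+1 + #|L|.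
  rewrite nbhdy (leq_trans (leq_card_setU _ _)) // leq_add2r.
  by rewrite (leq_trans (leq_card_setU _ _)) // cards1.
pose yl := [set (y, w) | w in nbhd g A y].
pose yr := [set (w, y) | w in nbhd g A y].
have s1 : arcs g A \subset arcs g (A :\ y) :|: yl :|: yr.
  apply/fintype.subsetP => -[a b]; rewrite !inE /= => /and3P[aA bA gab].
  have [ay|ay] /= := eqVneq a y.
    by subst a; apply/orP; left; apply/imsetP; exists b; rewrite // !inE bA.
  have [by_|by_] /= := eqVneq b y.
    subst b; rewrite ?andbF /=; apply/orP; right; apply/imsetP; exists a; rewrite // !inE aA.
    by rewrite gC.
  by rewrite aA bA gab.
pose xl := [set (x, w) | w in L]; pose xr := [set (w, x) | w in L].
have cardL : (#|xl| = #|L|) * (#|xr| = #|L|).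
  by split; apply: card_imset => a b [].
have s2 : arcs g (A :\ y) :|: (xl :|: xr) \subset arcs (contract g x y) (A :\ y).
  apply/fintype.subsetP => -[a b]; rewrite !inE /contract /=.
  case/or3P=> [/and3P[/andP[ay aA] /andP[by_ bA] gab]|/imsetP[w]|/imsetP[w]].
  - by rewrite ay aA by_ bA gab /= andbT; apply: contraTneq gab => ->; rewrite gI.
  - rewrite inE => /and4P[wA wx gyw gxw] [-> ->].
    have wy : w != y by apply: contraTneq gyw => ->; rewrite gI.
    by rewrite [x == y]eq_sym yx xA wA eqxx gyw [x == w]eq_sym wx wy orbT.
  - rewrite inE => /and4P[wA wx gyw gxw] [-> ->].
    have wy : w != y by apply: contraTneq gyw => ->; rewrite gI.
    by rewrite [x == y]eq_sym yx xA wA eqxx [g w y]gC gyw wx wy !orbT.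
have d1 : [disjoint arcs g (A :\ y) & xl :|: xr].
  rewrite finset.disjoints_subset; apply/fintype.subsetP => -[a b]; rewrite !inE /= => /and3P[_ _ gab].
  apply/negP => /orP[] /imsetP[w]; rewrite inE => /and4P[_ _ _ /negP gxw] [ea eb]; apply: gxw.
    by rewrite -ea -eb.
  by rewrite gC -ea -eb.
have d2 : [disjoint xl & xr].
  rewrite finset.disjoints_subset; apply/fintype.subsetP => -[a b] /imsetP[w wL [-> ->]].
  rewrite inE; apply/negP => /imsetP[w' w'L [e _]].
  by move: w'L; rewrite -e inE eqxx andbF.
have := subset_leq_card s1; have := subset_leq_card s2.
rewrite (eqTleqif (finset.leq_card_setU _ _) d1) (eqTleqif (finset.leq_card_setU _ _) d2) !cardL.
have := leq_card_setU (arcs g (A :\ y) :|: yl) yr.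
have := leq_card_setU (arcs g (A :\ y)) yl.
have -> : #|yl| = #|nbhd g A y| by apply: card_imset => a b [].
have -> : #|yr| = #|nbhd g A y| by apply: card_imset => a b [].
move=> [+ _] [+ _]; lia.
Qed.

Lemma dense_Kmodel t g A : symmetric g -> irreflexive g -> A != finset.set0 ->
  2 ^ t * #|A| <= #|arcs g A| -> Kmodel t.+1 g A.
Proof.
elim: t g A => [|t IHt] g A; first by move=> _ _ A0 _; exact: Kmodel1.
have [n] := ubnP #|A|; elim: n g A => // n IHn g A An gC gI A0 dense.
(* Contracting such an edge removes one vertex and at most [2 ^ t.+1] arcs, so the density
   hypothesis survives. *)
have [/existsP[x /existsP[y /and4P[xA yA gxy small]]]|/existsPn noxy] := boolP
  [exists x, [exists y, [&& x \in A, y \in A, g x y &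
     (#|nbhd g (nbhd g A x) y|.+1).*2 <= 2 ^ t.+1]]].
  have yx : y != x by apply: contraTneq gxy => ->; rewrite gI.
  have cardA : #|A| = #|A :\ y|.+1 by rewrite (cardsD1 y) yA.
  apply: (Kmodel_contract gC gxy xA yA); apply: IHn.
  - by rewrite -ltnS -cardA.
  - move=> a b; rewrite /contract eq_sym [g b a]gC.
    by case: (g a b) (a != b) => [] //=; rewrite orbC [g y b]gC [g y a]gC.
  - by move=> a; rewrite /contract eqxx.
  - by apply/set0Pn; exists x; rewrite !inE eq_sym yx.
  - have := arcs_contract gC gI gxy xA yA; move: dense small.
    rewrite cardA mulnS => h1 h2 h3.
    rewrite -(leq_add2l (2 ^ t.+1)) (leq_trans h1) // (leq_trans h3) //.
    by rewrite addnC leq_add2r.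
(* Otherwise every edge has at least [2 ^ t] common neighbours. A nonempty neighbourhood then has
   inner degrees at least [2 ^ t]: it contains the smaller model, and its centre is the cone
   point. *)
have codeg x y : x \in A -> y \in A -> g x y -> 2 ^ t <= #|nbhd g (nbhd g A x) y|.
  move=> xA yA gxy; have /existsPn/(_ y) := noxy x.
  by rewrite xA yA gxy /= -ltnNge expnS mul2n ltn_double ltnS.
have : 0 < #|arcs g A|.
  by apply: leq_trans dense; rewrite muln_gt0 expn_gt0 card_gt0.
case/card_gt0P=> -[v w]; rewrite inE /= => /and3P[vA wA gvw].
have vN : v \notin nbhd g A v by rewrite inE gI andbF.
have NA : v |: nbhd g A v \subset A.
  by apply/fintype.subsetP => u; rewrite !inE => /predU1P[->|/andP[]].
apply: Kmodel_sub NA _; apply: Kmodel_cone vN _ _.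
  by move=> u; rewrite inE gC => /andP[].
apply: IHt => //; first by apply/set0Pn; exists w; rewrite inE wA.
rewrite card_arcs mulnC -sum_nat_const; apply: leq_sum => u.
by rewrite inE => /andP[uA gvu]; exact: codeg.
Qed.
End DenseModel.

(** * Sampling independent sets *)

Section Sampling.
Variable V : finType.
Implicit Types (A B M : {set V}) (g e : rel V).

(** The average degree in any nonempty [A] is below [k]. Peel off a vertex of degree below [k],
    direct its edges towards the rest, and repeat. *)
Lemma degenerate_orientation k g : symmetric g -> irreflexive g ->
  (forall A, A != finset.set0 -> #|arcs g A| < k * #|A|) ->
  exists out : V -> {set V},
  [/\ forall v, #|out v| <= k, forall v w, w \in out v -> g v w &
      forall u v, g u v -> v \in out u \/ u \in out v].
Proof.
move=> gC gI sparse.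
suff H : forall A, exists out : V -> {set V},
  [/\ forall v, #|out v| <= k, forall v w, w \in out v -> g v w &
      forall u v, u \in A -> v \in A -> g u v -> v \in out u \/ u \in out v].
  have [out [h1 h2 h3]] := H finset.setT; exists out; split=> // u v.
  by apply: h3; rewrite finset.in_setT.
move=> A; have [n] := ubnP #|A|; elim: n A => // n IH A An.
have [->|A0] := eqVneq A finset.set0.
  exists (fun=> finset.set0); split=> [v|v w|u v]; rewrite ?cards0 ?inE //.
have [x xA degx] : exists2 x, x \in A & #|nbhd g A x| < k.
  apply/exists_inP; apply: contraTT (sparse A A0) => /exists_inPn big.
  rewrite -leqNgt card_arcs mulnC -sum_nat_const; apply: leq_sum => u /big.
  by rewrite -leqNgt.
have [|out [h1 h2 h3]] := IH (A :\ x); first by move: An; rewrite (cardsD1 x A) xA.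
exists (fun v => if v == x then nbhd g A x else out v); split.
- by move=> v; case: eqP => // _; exact: ltnW.
- by move=> v w; case: eqP => [->|_]; [rewrite inE => /andP[]|exact: h2].
move=> u v uA vA guv.
have [ux|ux] := eqVneq u x; first by left; rewrite inE vA -ux.
have [vx|vx] := eqVneq v x; first by right; rewrite inE uA -vx gC.
by apply: h3 => //; rewrite !inE ?ux ?vx.
Qed.

(** A set is determined by its trace on [U :|: W] and by its modification that contains [U] and
    avoids [W]. *)
Lemma card_sets_between (U W : {set V}) : [disjoint U & W] ->
  2 ^ #|V| <= 2 ^ (#|U| + #|W|) * #|[set M : {set V} | (U \subset M) && [disjoint W & M]]|.
Proof.
move=> UW; set G := [set M : {set V} | _].
rewrite -[#|V|]finset.cardsT -card_powerset.
have <- : #|U :|: W| = #|U| + #|W| by apply/eqP; rewrite (finset.leq_card_setU U W).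
rewrite -card_powerset -cardsX.
pose f M := (M :&: (U :|: W), (M :|: U) :\: W).
have fI : injective f.
  move=> M N [/setP e1 /setP e2]; apply/setP => x; have := e1 x; have := e2 x.
  rewrite !inE; case: (x \in U); case: (x \in W) => //=; rewrite ?andbT ?orbF //.
rewrite -(card_imset _ fI); apply: subset_leq_card; apply/fintype.subsetP => _ /imsetP[M _ ->].
rewrite !inE /= finset.subsetIr /=; apply/andP; split.
  apply/fintype.subsetP => x xU; rewrite !inE xU orbT andbT.
  by rewrite (disjointFr UW).
rewrite finset.disjoints_subset; apply/fintype.subsetP => x xW.
by rewrite !inE xW.
Qed.

(* Keep a uniformly random set M of vertices and discard those with an out-neighbour
   in M.  What survives is independent in g, and the endpoints of an arc of e outside
   g survive together with probability at least 2^-(2k+2). *)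
Lemma arcs_sampling k g e m :
  symmetric g -> irreflexive g ->
  (forall A, A != finset.set0 -> #|arcs g A| < k * #|A|) ->
  (forall B, (forall u v, u \in B -> v \in B -> ~~ g u v) -> #|arcs e B| <= m) ->
  irreflexive e ->
  #|arcs (fun u v => e u v && ~~ g u v) finset.setT| <= 2 ^ (k + k + 2) * m.
Proof.
move=> gC gI sparse indep eI.
have [out [outk outg gout]] := degenerate_orientation gC gI sparse.
set P := arcs _ _.
pose core M := [set v in M | [disjoint out v & M]].
have coreI M u v : u \in core M -> v \in core M -> ~~ g u v.
  rewrite !inE => /andP[uM ud] /andP[vM vd]; apply/negP => /gout[uo|vo].
    by have := disjointFr ud uo; rewrite vM.
  by have := disjointFr vd vo; rewrite uM.
have key p : p \in P ->
   2 ^ #|V| <= 2 ^ (k + k + 2) * #|[set M : {set V} | p \in arcs e (core M)]|.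
  case: p => u v; rewrite inE /= => /and3P[_ _ /andP[euv guv]].
  have uv : u != v by apply: contraTneq euv => ->; rewrite eI.
  (* Both ends survive once [M] contains [U] and misses [W]. These are disjoint since [uv] is not an
     edge of [g]; their sizes are at most 2 and [k + k]. *)
  pose U := [set u; v]; pose W := out u :|: out v.
  have UW : [disjoint U & W].
    rewrite finset.disjoints_subset; apply/fintype.subsetP => x; rewrite !inE => xU.
    apply/negP => /orP[] /outg gx; case/orP: xU => /eqP ex; subst x.
    - by rewrite gI in gx.
    - by rewrite gx in guv.
    - by rewrite gC gx in guv.
    - by rewrite gI in gx.
  apply: leq_trans (card_sets_between UW) _; apply: leq_mul.
    rewrite leq_exp2l // addnC leq_add //; last by rewrite cards2; case: eqP.
    by rewrite (leq_trans (leq_card_setU _ _)) // leq_add.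
  apply: subset_leq_card; apply/fintype.subsetP => M.
  rewrite !inE /= => /andP[/fintype.subsetP UM /disjointFr WM].
  have dj w : w \in U -> [disjoint out w & M].
    move=> wU; rewrite finset.disjoints_subset; apply/fintype.subsetP => x xw.
    rewrite inE WM // inE; move: wU; rewrite !inE => /orP[] /eqP <-; by rewrite xw ?orbT.
  by rewrite !UM ?dj ?euv // !inE eqxx ?orbT.
have tot : \sum_(M : {set V}) #|arcs e (core M)| <= 2 ^ #|V| * m.
  rewrite -[#|V|]finset.cardsT -card_powerset -sum_nat_const.
  rewrite [leqRHS](eq_bigl xpredT); last by move=> M; rewrite !inE finset.subsetT.
  by apply: leq_sum => M _; apply: indep; exact: coreI.
rewrite -(leq_pmul2l (expn_gt0 2 #|V|)).
rewrite mulnC -sum_nat_const (leq_trans (leq_sum _ key)) //.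
rewrite -big_distrr /= mulnCA leq_mul2l; apply/orP; right.
apply: leq_trans tot.
(* Double counting of the pairs of an arc and a set [M] whose core spans it. *)
rewrite (eq_bigr (fun p => \sum_(M : {set V} | p \in arcs e (core M)) 1)); last first.
  by move=> p _; rewrite sum1dep_card.
rewrite (exchange_big_dep xpredT) //=; apply: leq_sum => M _.
rewrite sum1dep_card; apply: subset_leq_card; apply/fintype.subsetP => p.
by rewrite inE => /andP[].
Qed.

End Sampling.

(** * Plane drawings *)

Section Drawing.
Local Open Scope ring_scope.
Local Open Scope classical_set_scope.
Variables (R : realType) (V : finType) (adj : rel V).
Variables (pos : V -> R * R) (arc : V -> V -> R -> R * R).
Hypothesis drawn : topological_graph adj pos arc.
Variable g : rel V.
Hypothesis gC : symmetric g.
Hypothesis g_adj : forall u v, g u v -> adj u v.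
Hypothesis g_planar : forall u v x y, g u v -> g x y ->
  u != x -> u != y -> v != x -> v != y ->
  arc_img (arc u v) `&` arc_img (arc x y) = set0.

(** The vertex points are added for vertices with no edge inside [S]. *)
Definition drawing (S : {set V}) : set (R * R) :=
  (\bigcup_(e in [set e | e \in arcs g S]) arc_img (arc e.1 e.2))
    `|` pos @` [set v | v \in S].

Lemma arc_img_compact u v : adj u v -> compact (arc_img (arc u v)).
Proof.
case: drawn => _ _ H _ _ /H[[cont _] _ _ _].
apply: continuous_compact cont _.
have -> : @unit_int R = `[0, 1]%classic.
  by apply/seteqP; split=> t /=; rewrite /unit_int /= in_itv.
exact: segment_compact.
Qed.

Lemma arc_img_connected u v : adj u v -> connected (arc_img (arc u v)).
Proof.
case: drawn => _ _ H _ _ /H[[cont _] _ _ _].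
apply: connected_continuous_connected cont.
have -> : @unit_int R = `[0, 1]%classic.
  by apply/seteqP; split=> t /=; rewrite /unit_int /= in_itv.
exact: segment_connected.
Qed.

Lemma arc_img_ends u v : adj u v ->
  arc_img (arc u v) (pos u) /\ arc_img (arc u v) (pos v).
Proof.
case: drawn => _ _ H _ _ /H[_ <- <- _].
by split; [exists 0|exists 1] => //; rewrite /unit_int /= ?lexx ?ler01.
Qed.

Lemma drawing_compact S : compact (drawing S).
Proof.
apply: compactU; last by apply: finite_compact; apply: finite_image; exact: finite_finpred.
have -> : [set e | e \in arcs g S] = [set` enum (arcs g S)].
  by apply/seteqP; split=> e /=; rewrite mem_enum.
rewrite bigcup_seq big_seq_cond; apply: bigsetU_compact => -[u v].
rewrite andbT mem_enum inE => /and3P[_ _ guv].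
exact/arc_img_compact/g_adj.
Qed.

(** Arcs inside [S] and inside [T] belong to independent edges, and an arc meets no vertex other
    than its ends. *)
Lemma drawing_disjoint (S T : {set V}) : [disjoint S & T]%B -> drawing S `&` drawing T = set0.
Proof.
case: drawn => _ posI _ off _ ST.
have ne a b : a \in S -> b \in T -> a != b.
  by move=> aS; apply: contraTneq => <-; rewrite (disjointFr ST).
rewrite -subset0 => p [].
case=> [[[u v]]|[w wS <-]]; rewrite /= ?inE.
- move=> /and3P[/= uS vS guv] pu.
  case=> [[[x y]]|[w wS wp]]; rewrite /= ?inE.
    move=> /and3P[/= xT yT gxy] px.
    have /seteqP[disj _] : arc_img (arc u v) `&` arc_img (arc x y) = set0.
      by apply: g_planar => //; rewrite ne.
    exact: (disj p).
  apply: (off u v w (g_adj guv)); last by rewrite wp.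
  - by rewrite eq_sym ne.
  - by rewrite eq_sym ne.
- case=> [[[x y]]|[w' w'T]]; rewrite /= ?inE.
    move=> /and3P[/= xT yT gxy] px.
    by apply: (off x y w (g_adj gxy)); rewrite ?ne.
  by move=> /posI ww; have := ne w w' wS w'T; rewrite ww eqxx.
Qed.

Lemma drawing_chain d (S : {set V}) u v : 0 < d -> u \in S -> connect (inside g S) u v ->
  exists s, [/\ path (in_box d) (pos u) s, last (pos u) s = pos v &
    forall a, a \in pos u :: s -> drawing S a].
Proof.
move=> d0 uS /connectP[p + ->]; elim: p u uS => [|w p IH] u uS /=.
  move=> _; exists [::]; split=> // a; rewrite inE => /eqP ->.
  by right; exists u.
case/andP=> /and3P[_ wS guw] /(IH w wS)[s [ps ls sS]].
have auw := g_adj guw.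
have [pu pw] := arc_img_ends auw.
have [t [pt lt tS]] := connected_chain (arc_img_connected auw) d0 pu pw.
exists (t ++ s); split.
- by rewrite cat_path pt lt.
- by rewrite last_cat lt.
- move=> a; rewrite -cat_cons mem_cat => /orP[/tS|aS].
    by left; exists (u, w) => //=; rewrite inE /= uS wS.
  by apply: sS; rewrite inE aS orbT.
Qed.

Lemma planar_no_K5model (A : {set V}) : ~ Kmodel 5 g A.
Proof.
case=> c [S [[_ cI] SA _ Sd]].
(* There are finitely many pairs of vertex sets, so one [d] separates all disjoint pairs. *)
have : \forall d \near 0^'+, forall ST : {set V} * {set V}, [disjoint ST.1 & ST.2]%B ->
    forall a b, drawing ST.1 a -> drawing ST.2 b -> ~~ in_box d a b.
  apply: filter_forall => -[S1 S2] /=.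
  case: (boolP [disjoint S1 & S2]%B) => d12; last by apply: nearW.
  have := compact_separated (@drawing_compact S1) (@drawing_compact S2) (drawing_disjoint d12).
  by apply: filterS => d H _.
move=> near_sep; have [d [d0 sep]] : exists d : R, 0 < d /\ forall S1 S2 : {set V},
    [disjoint S1 & S2]%B -> forall a b, drawing S1 a -> drawing S2 b -> ~~ in_box d a b.
  have := filter_ex (filterI (nbhs_right_gt 0) near_sep).
  move=> [d [d0 H]]; exists d; split=> // S1 S2; exact: (H (S1, S2)).
(* [no_planar_K5] asks for separation by four times the step length. *)
have d4 : 0 < d / 4 by rewrite divr_gt0.
have /choice[s sP] (ij : nat * nat) : exists s, (ij.1 < ij.2 < 5)%N ->
    [/\ path (in_box (d / 4)) (pos (c ij.1)) s, last (pos (c ij.1)) s = pos (c ij.2) &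
    forall a, a \in pos (c ij.1) :: s -> drawing (S ij.1 ij.2) a].
  case: (boolP (ij.1 < ij.2 < 5)%N) => ij5; last by exists [::].
  have [_ ci _ cn] := SA _ _ ij5.
  by have [s sP] := drawing_chain d4 ci cn; exists s.
apply: (@no_planar_K5 R (d / 4) (pos \o c) (fun i j => s (i, j))).
- by move=> i j ij; have [] := sP (i, j) ij.
- by move=> i j ij; have [] := sP (i, j) ij.
- move=> i j ij; case: drawn => _ posI _ _ _.
  by rewrite (inj_eq posI) cI.
- move=> i j k l ij kl ik il jk jl a b ha hb.
  have -> : d / 4 *+ 4 = d by lra.
  apply: sep (Sd _ _ _ _ ij kl ik il jk jl) _ _ _ _.
  + by have [_ _] := sP (i, j) ij; apply.
  + by have [_ _] := sP (k, l) kl; apply.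
Qed.

(** The factor [2 ^ 4] is the density at which [dense_Kmodel] yields five branch vertices. *)
Lemma planar_sparse (A : {set V}) : A != finset.set0 -> (#|arcs g A| < 2 ^ 4 * #|A|)%N.
Proof.
move=> A0; rewrite ltnNge; apply/negP => dense.
apply: (@planar_no_K5model A); apply: dense_Kmodel dense => //.
move=> u; apply/negbTE/negP => /g_adj; case: drawn => [[/(_ u) + _]] _ _ _ _.
exact/negP.
Qed.

End Drawing.

(** * The linear edge bound *)

Lemma num_edges_le (V : finType) (adj : rel V) : num_edges adj <= #|arcs adj finset.setT|.
Proof.
apply: leq_trans (leq_imset_card _ _) _; apply: subset_leq_card.
by apply/fintype.subsetP => p; rewrite !inE.
Qed.

Section Main.
Local Open Scope classical_set_scope.
Variables (R : realType) (V : finType) (adj : rel V).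
Variables (pos : V -> (R * R)%type) (arc : V -> V -> R -> (R * R)%type).
Hypothesis drawn : topological_graph adj pos arc.

Lemma arc_img_rev u v : adj u v -> arc_img (arc v u) = arc_img (arc u v).
Proof.
have sub x y : adj x y -> arc_img (arc y x) `<=` arc_img (arc x y).
  case: drawn => _ _ /(_ x y) H _ _ /H[_ _ _ rev] _ [t t01 <-].
  exists (1 - t)%R; last by rewrite rev.
  by move: t01; rewrite /unit_int /= subr_ge0 lerBlDr lerDl andbC.
move=> uv; apply/seteqP; split; apply: sub => //.
by case: drawn => [[_ <-]].
Qed.

Lemma uncrossed_disjoint u v x y : adj u v -> adj x y ->
  u != x -> u != y -> v != x -> v != y -> ~ edges_cross adj arc u v x y ->
  arc_img (arc u v) `&` arc_img (arc x y) = set0.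
Proof.
case: drawn => _ _ _ _ H uv xy ux uy vx vy nc.
have [] := H u v x y uv xy.
  by rewrite negb_or !negb_and ux uy.
move=> _ {}H; rewrite -subset0 => p [pu px].
have [[w [/orP[] /eqP ->]]|cr] := H p pu px.
- by rewrite (negbTE ux) (negbTE uy).
- by rewrite (negbTE vx) (negbTE vy).
- by apply: nc; split=> //; split=> //; exists p.
Qed.

(** [crossing_free] refers to one direction of an arc; the disjunction makes the relation symmetric
    by construction. *)
Let free : rel V := fun u v =>
  `[< crossing_free adj arc u v \/ crossing_free adj arc v u >].

Lemma free_adj u v : free u v -> adj u v.
Proof. by case: drawn => [[_ C] _ _ _ _] /asboolP[[uv _]|[vu _]]; rewrite // C. Qed.

Lemma free_sparse (A : {set V}) : A != finset.set0 -> #|arcs free A| < 2 ^ 4 * #|A|.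
Proof.
case: (drawn) => [[_ C] _ _ _ _].
apply: (planar_sparse drawn); first by move=> u v; apply/asboolP/asboolP => -[]; auto.
  exact: free_adj.
move=> u v x y guv gxy ux uy vx vy.
have uv := free_adj guv; have xy := free_adj gxy.
move/asboolP: guv => [[_ nc]|[_ nc]]; first exact: uncrossed_disjoint.
by rewrite -arc_img_rev //; apply: uncrossed_disjoint; rewrite // C.
Qed.

Hypothesis crossing_joined : forall u v x y, edges_cross adj arc u v x y ->
  exists a b, [/\ (a == u) || (a == v), (b == x) || (b == y) & crossing_free adj arc a b].

(** A crossing inside [B] would give a crossing-free edge joining two vertices of [B]. *)
Lemma independent_sparse (B : {set V}) : (forall u v, u \in B -> v \in B -> ~~ free u v) ->
  #|arcs adj B| <= 2 ^ 4 * #|V|.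
Proof.
move=> indep; case: (drawn) => [[_ C] _ _ _ _].
pose g : rel V := fun u v => [&& u \in B, v \in B & adj u v].
have -> : arcs adj B = arcs g B.
  by apply/setP => -[u v]; rewrite !inE /g /=; case: (u \in B); case: (v \in B).
have [->|B0] := eqVneq B finset.set0.
  by rewrite (_ : arcs _ _ = finset.set0) ?cards0 //; apply/setP => e; rewrite !inE.
have : #|arcs g B| < 2 ^ 4 * #|B|.
  apply: (planar_sparse drawn) => //.
  - by move=> u v; rewrite /g C andbCA.
  - by move=> u v /and3P[].
  - move=> u v x y /and3P[uB vB uv] /and3P[xB yB xy] ux uy vx vy.
    apply: uncrossed_disjoint => // /crossing_joined[a [b [au bx ab]]].
    have aB : a \in B by case/orP: au => /eqP ->.
    have bB : b \in B by case/orP: bx => /eqP ->.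
    by have /asboolP := indep a b aB bB; apply; left.
by move/ltnW/leq_trans; apply; rewrite leq_mul2l max_card orbT.
Qed.

(** The first summand bounds the arcs of [free], the second the others, by [arcs_sampling] with
    [k = 2 ^ 4] and [m = 2 ^ 4 * #|V|]. *)
Lemma num_edges_linear :
  num_edges adj <= (2 ^ 4 + 2 ^ (2 ^ 4 + 2 ^ 4 + 2) * 2 ^ 4) * #|V|.
Proof.
case: (drawn) => [[adjI C] _ _ _ _].
have freeC : symmetric free by move=> u v; apply/asboolP/asboolP => -[]; auto.
have freeI : irreflexive free.
  by move=> u; apply/negbTE/negP => /free_adj; exact/negP.
have adjI' : irreflexive adj by move=> u; exact/negbTE.
have := arcs_sampling freeC freeI free_sparse independent_sparse adjI'.
set P := arcs _ _ => HP.
apply: leq_trans (num_edges_le adj) _.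
have sub : arcs adj finset.setT \subset arcs free finset.setT :|: P.
  apply/fintype.subsetP => -[u v]; rewrite !inE /= => ->.
  by case: (free u v).
apply: leq_trans (subset_leq_card sub) _.
apply: leq_trans (leq_card_setU _ _) _.
rewrite mulnDl -mulnA; apply: leq_add HP.
(* The strict bound [free_sparse] needs a nonempty set, so an empty graph is treated apart. *)
have [->|V0] := eqVneq [set: V]%SET finset.set0.
  by rewrite (_ : arcs _ _ = finset.set0) ?cards0 //; apply/setP => e; rewrite !inE.
by rewrite -finset.cardsT; apply/ltnW/free_sparse.
Qed.

End Main.

Theorem theorem1 :
  exists c : nat,
  forall (R : realType) (V : finType) (adj : rel V) (pos : V -> (R * R)%type)
         (arc : V -> V -> R -> (R * R)%type),
    topological_graph adj pos arc ->
    (forall u v x y, edges_cross adj arc u v x y ->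
       [/\ u != x, u != y, v != x & v != y] /\
       exists a b, [/\ (a == u) || (a == v), (b == x) || (b == y) &
                       crossing_free adj arc a b]) ->
    (num_edges adj <= c * #|V|)%N.
Proof.
exists (2 ^ 4 + 2 ^ (2 ^ 4 + 2 ^ 4 + 2) * 2 ^ 4)%N => R V adj pos arc drawn joined.
by apply: num_edges_linear drawn _ => u v x y /joined[].
Qed.
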